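(* Let $k$ be a field and $a,b$ coprime positive integers such that $\mathrm{char}(k)$ divides neither $a$ nor $b$. Let $A=k[s^a,s^b]\subseteq k[s]$, $m_1=b(a-1)$, $m_2=a(b-1)$, and let $\mathcal{H}_{\mathrm{HH}^*(A)}(x,y)=\sum_{(m,n)\in\mathbb{N}_0\times\mathbb{Z}}\dim_k(\mathbf{H}_{m,n})x^my^n$ be the Hilbert series of $\mathrm{HH}^*(A)$, where $\mathbf{H}_{m,n}$ is the component of cohomological degree $m$ and weight $n$. Then $$\mathcal{H}_{\mathrm{HH}^*(A)}(x,y)=\mathrm{H}_1+\mathrm{H}_2+\mathrm{H}_3,$$ where $$\mathrm{H}_1=\frac{1-y^{ab}}{(1-y^a)(1-y^b)},$$ $\mathrm{H}_2=\mathrm{H}_{21}-(\mathrm{H}_{22}+\mathrm{H}_{23})+\mathrm{H}_{24}$ with $$\mathrm{H}_{21}=\frac{x^2y^{-ab}}{1-x^2y^{-ab}}\,\mathrm{H}_1,\quad \mathrm{H}_{22}=\frac{x^2y^{-ab}}{1-x^2y^{-ab}}\,y^{m_1}\mathrm{H}_1,\quad \mathrm{H}_{23}=\frac{x^2y^{-ab}}{1-x^2y^{-ab}}\,y^{m_2}\mathrm{H}_1,$$ $$\mathrm{H}_{24}=\frac{x^2y^{-ab}}{1-x^2y^{-ab}}\left(y^{m_1+m_2}+y^{ab}\mathrm{H}_1\right),$$ and $\mathrm{H}_3=\mathrm{H}_{31}+\mathrm{H}_{32}-\mathrm{H}_{33}$ with $$\mathrm{H}_{31}=xy^{ab-a-b}+x\mathrm{H}_1,\quad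 \mathrm{H}_{32}=x\,\frac{x^2y^{-ab}}{1-x^2y^{-ab}}\,\mathrm{H}_1,\quad \mathrm{H}_{33}=xy^{ab-a-b}\,\frac{x^2y^{-ab}}{1-x^2y^{-ab}}\,(\mathrm{H}_1-1).$$
   Context: $\mathrm{HH}^*(A)=\bigoplus_{i\ge 0}\mathrm{Ext}^i_{A^e}(A,A)$, $A^e=A\otimes_k A^{op}$. It is bigraded by $\mathbb{N}_0\times\mathbb{Z}$: the first degree is cohomological, the second is the weight induced by giving $s$ weight $1$. Concretely, $\mathrm{HH}^*(A)$ is the cohomology of the complex with $k$-basis the elements $(e_It^{(q)},s^\alpha)$, $I\subseteq\{1,2\}$, $q\ge 0$, $\alpha\in S=\{ua+vb\mid u,v\in\mathbb{N}_0\}$, of bidegree $(|I|+2q,\ \alpha-b[1\in I]-a[2\in I]-qab)$ (with $[P]=1$ if $P$ is true and $0$ otherwise) and differential $\partial(t^{(q)},s^\alpha)=0$, $\partial(e_1t^{(q)},s^\alpha)=a(t^{(q+1)},s^{\alpha+m_1})$, $\partial(e_2t^{(q)},s^\alpha)=-b(t^{(q+1)},s^{\alpha+m_2})$, $\partial(e_1\wedge e_2t^{(q)},s^\alpha)=b(e_1t^{(q+1)},s^{\alpha+m_2})+a(e_2t^{(q+1)},s^{\alpha+m_1})$. Rational expressions are expanded as power series in $x$ with coefficients Laurent series in $y$. *)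

(* Defs.v *)
From HB Require Import structures.
From mathcomp Require Import all_boot all_order all_algebra.
From mathcomp Require Import boolp classical_sets cardinality fsbigop.
From mathcomp Require Import finmap zify.
From mathcomp Require Import monalg.

Set Implicit Arguments.
Unset Strict Implicit.
Unset Printing Implicit Defensive.

Import Order.TTheory GRing.Theory Num.Theory.

Local Open Scope ring_scope.

(* ------------------------------------------------------------------------ *)
(* Formal power series R[[x]]. The ring structure is obtained from {poly R}
   by truncation. *)

Record pseries (R : Type) := PSeries { pscoef : nat -> R }.

HB.instance Definition _ (R : Type) := gen_eqMixin (pseries R).
HB.instance Definition _ (R : Type) := gen_choiceMixin (pseries R).

Lemma pseriesP (R : Type) (f g : pseries R) :
  (forall n, pscoef f n = pscoef g n) -> f = g.
Proof. by case: f g => [f] [g] /= fg; congr PSeries; apply/funext. Qed.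

Section PSeriesRing.
Variable R : comNzRingType.
Implicit Types f g h : pseries R.

Definition ps_zero : pseries R := PSeries (fun=> 0).
Definition ps_add f g := PSeries (fun n => pscoef f n + pscoef g n).
Definition ps_opp f := PSeries (fun n => - pscoef f n).
Definition ps_const (c : R) := PSeries (fun n => if n == 0%N then c else 0).
Definition ps_mul f g :=
  PSeries (fun n => \sum_(i < n.+1) pscoef f i * pscoef g (n - i)).

Definition ps_trunc N f : {poly R} := \poly_(i < N) pscoef f i.

Lemma ps_mulE N f g n : (n < N)%N ->
  pscoef (ps_mul f g) n = (ps_trunc N f * ps_trunc N g)`_n.
Proof.
move=> nN; rewrite coefM /=; apply: eq_bigr => i _.
have iN : (i < N)%N by apply: leq_ltn_trans nN; rewrite -ltnS.
by rewrite !coef_poly iN (leq_ltn_trans (leq_subr _ _) nN).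
Qed.

Fact ps_addA : associative ps_add.
Proof. by move=> f g h; apply: pseriesP => n /=; rewrite addrA. Qed.
Fact ps_addC : commutative ps_add.
Proof. by move=> f g; apply: pseriesP => n /=; rewrite addrC. Qed.
Fact ps_add0 : left_id ps_zero ps_add.
Proof. by move=> f; apply: pseriesP => n /=; rewrite add0r. Qed.
Fact ps_addN : left_inverse ps_zero ps_opp ps_add.
Proof. by move=> f; apply: pseriesP => n /=; rewrite addNr. Qed.

HB.instance Definition _ :=
  GRing.isZmodule.Build (pseries R) ps_addA ps_addC ps_add0 ps_addN.

Fact ps_mulC : commutative ps_mul.
Proof. by move=> f g; apply: pseriesP => n; rewrite !(ps_mulE (N := n.+1)) // mulrC. Qed.

Fact ps_mulA : associative ps_mul.
Proof.
move=> f g h; apply: pseriesP => n.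
have mulT u v (i : 'I_n.+1) : (ps_trunc n.+1 (ps_mul u v))`_i =
    (ps_trunc n.+1 u * ps_trunc n.+1 v)`_i.
  by rewrite coef_poly ltn_ord (ps_mulE (N := n.+1)).
rewrite !(ps_mulE (N := n.+1)) //.
transitivity ((ps_trunc n.+1 f * (ps_trunc n.+1 g * ps_trunc n.+1 h))`_n).
  rewrite coefMr [RHS]coefMr; apply: eq_bigr => i _; congr (_ * _).
  exact: mulT.
rewrite mulrA coefM [RHS]coefM; apply: eq_bigr => i _; congr (_ * _).
by rewrite mulT.
Qed.

Fact ps_mul1 : left_id (ps_const 1) ps_mul.
Proof.
move=> f; apply: pseriesP => n /=; rewrite big_ord_recl /= mul1r subn0.
by rewrite big1 ?addr0 // => i _; rewrite mul0r.
Qed.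

Fact ps_mulD : left_distributive ps_mul ps_add.
Proof.
move=> f g h; apply: pseriesP => n /=; rewrite -big_split /=.
by apply: eq_bigr => i _; rewrite mulrDl.
Qed.

Fact ps_one_neq0 : ps_const 1 != 0.
Proof.
by apply/eqP => /(congr1 (fun f => pscoef f 0)) /= /eqP; rewrite oner_eq0.
Qed.

HB.instance Definition _ := GRing.Zmodule_isComNzRing.Build (pseries R)
  ps_mulA ps_mulC ps_mul1 ps_mulD ps_one_neq0.

Definition ps_X : pseries R := PSeries (fun n => (n == 1%N)%:R).

(* f^-1 is the inverse of f whenever f has one; invertibility is not assumed
   decidable on R, hence the classical choice. *)
Definition ps_unit : {pred pseries R} := fun f => `[< exists g, g * f = 1 >].
Definition ps_inv f : pseries R :=
  if pselect (exists g, g * f = 1) is left e then projT1 (cid e) else f.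

Fact ps_mulV : {in ps_unit, left_inverse 1 ps_inv *%R}.
Proof.
move=> f /asboolP uf; rewrite /ps_inv; case: pselect => [e|//].
exact: projT2 (cid e).
Qed.
Fact ps_unitP f g : g * f = 1 -> ps_unit f.
Proof. by move=> gf; apply/asboolP; exists g. Qed.
Fact ps_inv_out : {in [predC ps_unit], ps_inv =1 id}.
Proof.
by move=> f /asboolP nuf; rewrite /ps_inv; case: pselect.
Qed.

HB.instance Definition _ := GRing.ComNzRing_hasMulInverse.Build (pseries R)
  ps_mulV ps_unitP ps_inv_out.

End PSeriesRing.

(* ------------------------------------------------------------------------ *)
(* Formal Laurent series R((y)): functions on the integers whose support is
   bounded below. *)

Record laurent (R : nmodType) := Laurent {
  lcoef : int -> R;
  lcoef_bound : exists N : nat, forall n : int, n < - N%:Z -> lcoef n = 0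
}.

HB.instance Definition _ (R : nmodType) := gen_eqMixin (laurent R).
HB.instance Definition _ (R : nmodType) := gen_choiceMixin (laurent R).

Lemma laurentP (R : nmodType) (f g : laurent R) :
  (forall n, lcoef f n = lcoef g n) -> f = g.
Proof.
case: f g => [f bf] [g bg] /= /funext fg; case: _ / fg bg => bg.
by congr Laurent; apply: Prop_irrelevance.
Qed.

Section LaurentRing.
Variable R : comNzRingType.
Implicit Types f g h : laurent R.

Definition lbounded N f := forall n : int, n < - N%:Z -> lcoef f n = 0.

Lemma lboundedW N M f : (N <= M)%N -> lbounded N f -> lbounded M f.
Proof.
move=> NM fN n nM; apply: fN; apply: (lt_le_trans nM).
by rewrite lerN2 lez_nat.
Qed.

Lemma lbounded2 f g : exists N, lbounded N f /\ lbounded N g.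
Proof.
have [[N fN] [M gM]] := (lcoef_bound f, lcoef_bound g).
exists (maxn N M); split.
- by apply: (lboundedW (leq_maxl N M)).
- by apply: (lboundedW (leq_maxr N M)).
Qed.

(* y^N f, as a power series *)
Definition lshift N f : pseries R := PSeries (fun i => lcoef f (i%:Z - N%:Z)).

Lemma lshift_inj N f g : lbounded N f -> lbounded N g ->
  lshift N f = lshift N g -> f = g.
Proof.
move=> fN gN fg; apply: laurentP => n.
have [nN|Nn] := ltP n (- N%:Z); first by rewrite fN ?gN.
have [i ->] : exists i : nat, n = i%:Z - N%:Z by exists (absz (n + N%:Z)); lia.
by move/(congr1 (fun s => pscoef s i)): fg.
Qed.

(* The sum has finitely many nonzero terms, so the convention that a sum of
   infinite support is 0 plays no role. *)
Definition lmul_coef f g (n : int) : R :=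
  \sum_(i \in [set: int]) lcoef f i * lcoef g (n - i).

Lemma lmul_coefE N M f g (k : nat) : lbounded N f -> lbounded M g ->
  lmul_coef f g (k%:Z - (N + M)%N%:Z) = pscoef (lshift N f * lshift M g) k.
Proof.
move=> fN gM; rewrite /lmul_coef.
pose F i := lcoef f i * lcoef g (k%:Z - (N + M)%N%:Z - i).
pose r := [seq i%:Z - N%:Z | i <- iota 0 k.+1].
have -> : \sum_(i \in [set: int]) F i = \sum_(i \in [set` r]) F i.
  apply/esym/fsbig_widen => //; move=> i [_ /= /negP ni]; rewrite /preimage /= /F.
  have [iN|Ni] := ltP i (- N%:Z); first by rewrite fN ?mul0r.
  rewrite [X in _ * X]gM ?mulr0 //; apply: contraNT ni; rewrite -leNgt => ik.
  by apply/mapP; exists (absz (i + N%:Z)); [rewrite mem_iota; lia|lia].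
rewrite -fsbig_seq; last by rewrite map_inj_uniq ?iota_uniq // => i j; lia.
rewrite big_map -[iota 0 k.+1]/(index_iota 0 k.+1) big_mkord /=.
apply: eq_bigr => i _; rewrite /F; congr (_ * lcoef g _).
by have := ltn_ord i; lia.
Qed.

Lemma lmul_coef_lt N M f g (n : int) : lbounded N f -> lbounded M g ->
  n < - (N + M)%N%:Z -> lmul_coef f g n = 0.
Proof.
move=> fN gM nNM; apply: fsbig1 => i _.
have [iN|Ni] := ltP i (- N%:Z); first by rewrite fN ?mul0r.
by rewrite gM ?mulr0 //; lia.
Qed.

Fact lmul_subproof f g :
  exists N : nat, forall n : int, n < - N%:Z -> lmul_coef f g n = 0.
Proof.
have [N [fN gN]] := lbounded2 f g.
by exists (N + N)%N => n; apply: lmul_coef_lt.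
Qed.

Fact ladd_subproof f g :
  exists N : nat, forall n : int, n < - N%:Z -> lcoef f n + lcoef g n = 0.
Proof.
have [N [fN gN]] := lbounded2 f g.
by exists N => n nN; rewrite fN // gN // addr0.
Qed.

Fact lopp_subproof f :
  exists N : nat, forall n : int, n < - N%:Z -> - lcoef f n = 0.
Proof. by have [N fN] := lcoef_bound f; exists N => n /fN ->; rewrite oppr0. Qed.

Fact lmono_subproof (c : R) (j : int) :
  exists N : nat, forall n : int, n < - N%:Z -> (if n == j then c else 0) = 0.
Proof. by exists (absz j) => n nN; case: eqP => // ?; lia. Qed.

Definition lmul f g := Laurent (lmul_subproof f g).
Definition ladd f g := Laurent (ladd_subproof f g).
Definition lopp f := Laurent (lopp_subproof f).
(* the monomial c y^j *)
Definition lmono (c : R) (j : int) := Laurent (lmono_subproof c j).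

Fact ladd_A : associative ladd.
Proof. by move=> f g h; apply: laurentP => n /=; rewrite addrA. Qed.
Fact ladd_C : commutative ladd.
Proof. by move=> f g; apply: laurentP => n /=; rewrite addrC. Qed.
Fact ladd_0 : left_id (lmono 0 0) ladd.
Proof. by move=> f; apply: laurentP => n /=; rewrite if_same add0r. Qed.
Fact ladd_N : left_inverse (lmono 0 0) lopp ladd.
Proof. by move=> f; apply: laurentP => n /=; rewrite if_same addNr. Qed.

HB.instance Definition _ :=
  GRing.isZmodule.Build (laurent R) ladd_A ladd_C ladd_0 ladd_N.

Lemma lmul_bounded N M f g :
  lbounded N f -> lbounded M g -> lbounded (N + M) (lmul f g).
Proof. by move=> fN gM n; apply: lmul_coef_lt. Qed.

Lemma lshiftM N M f g : lbounded N f -> lbounded M g ->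
  lshift (N + M) (lmul f g) = lshift N f * lshift M g.
Proof. by move=> fN gM; apply: pseriesP => k; rewrite -lmul_coefE. Qed.

Fact lmul_C : commutative lmul.
Proof.
move=> f g; have [N [fN gN]] := lbounded2 f g.
apply: (@lshift_inj (N + N)%N); rewrite ?lshiftM //; try exact: lmul_bounded.
by rewrite mulrC.
Qed.

Fact lmul_A : associative lmul.
Proof.
move=> f g h; have [N [fN gN]] := lbounded2 f g.
have [M hM] := lcoef_bound h.
have fgN := lmul_bounded fN gN; have ghN := lmul_bounded gN hM.
have shiftA : lshift (N + (N + M)) (lmul f (lmul g h)) =
              lshift N f * (lshift N g * lshift M h).
  by rewrite (lshiftM fN ghN) (lshiftM gN hM).
have shiftA' : lshift (N + (N + M)) (lmul (lmul f g) h) =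
               lshift N f * lshift N g * lshift M h.
  by rewrite addnA (lshiftM fgN hM) (lshiftM fN gN).
apply: (@lshift_inj (N + (N + M))%N); first exact: lmul_bounded.
- by rewrite addnA; apply: lmul_bounded.
- by rewrite shiftA shiftA' mulrA.
Qed.

Lemma lmono_bounded0 (c : R) : lbounded 0 (lmono c 0).
Proof. by move=> n n0 /=; case: eqP => // ?; lia. Qed.

Fact lmul_1 : left_id (lmono 1 0) lmul.
Proof.
move=> f; have [N fN] := lcoef_bound f.
apply: (@lshift_inj (0 + N)%N) => //.
  by apply: lmul_bounded => //; apply: lmono_bounded0.
rewrite lshiftM //; last exact: lmono_bounded0.
rewrite -[RHS]mul1r; congr (_ * _); apply: pseriesP => i /=.
by rewrite subr0.
Qed.

Fact lmul_D : left_distributive lmul ladd.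
Proof.
move=> f g h; have [N [fN gN]] := lbounded2 f g.
have [M hM] := lcoef_bound h.
have fgN : lbounded N (ladd f g) by move=> n nN /=; rewrite fN // gN // addr0.
apply: (@lshift_inj (N + M)%N); first exact: lmul_bounded.
  by move=> n nN /=; rewrite !(lmul_coef_lt (N := N) (M := M)) ?addr0.
rewrite lshiftM //.
have addE u v K : lshift K (ladd u v) = lshift K u + lshift K v.
  exact: pseriesP.
by rewrite !addE mulrDl !lshiftM.
Qed.

Fact lone_neq0 : lmono 1 0 != 0.
Proof.
by apply/eqP => /(congr1 (fun f => lcoef f 0)) /= /eqP; rewrite oner_eq0.
Qed.

HB.instance Definition _ := GRing.Zmodule_isComNzRing.Build (laurent R)
  lmul_A lmul_C lmul_1 lmul_D lone_neq0.

End LaurentRing.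

(* ------------------------------------------------------------------------ *)
(* The ring Z((y))[[x]], in which rational expressions are expanded: y,
   1 - y^n for n > 0, and 1 - x^m y^j for m > 0 are invertible there. *)

Definition xyseries := pseries (laurent int).

Definition ser_x : xyseries := ps_X (laurent int).
Definition ser_y : xyseries := ps_const (lmono 1 1).

(* the coefficient of x^m y^n *)
Definition ser_coef (f : xyseries) (m : nat) (n : int) : int :=
  lcoef (pscoef f m) n.

(* ------------------------------------------------------------------------ *)
(* The complex whose cohomology is HH^*(A), for A = k[s^a, s^b] with k-basis
   the s^alpha, alpha in the semigroup S generated by a and b: up to grading it
   is the sum of copies A e_I t^(q) of A over I \subseteq {1, 2} and q >= 0.
   The cell (e1, e2, q, alpha) stands for (e_I t^(q), s^alpha), where e1 and e2
   are the truth values of 1 \in I and 2 \in I; alpha is unrestricted in a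
   cell, and [cochain] imposes that it lies in S. *)

Definition cell : Type := (bool * bool * nat * nat)%type.

Section Complex.
Variables (k : fieldType) (a b : nat).

Definition in_S (al : nat) : Prop := exists u v : nat, al = (u * a + v * b)%N.

Definition bideg (c : cell) : nat * int :=
  let: (e1, e2, q, al) := c in
  ((e1 + e2 + 2 * q)%N,
   al%:Z - (b * e1)%N%:Z - (a * e2)%N%:Z - (q * (a * b))%N%:Z).

Definition cell_diff (c : cell) : {malg k[cell]} :=
  let m1 := (b * (a - 1))%N in
  let m2 := (a * (b - 1))%N in
  let: (e1, e2, q, al) := c in
  match e1, e2 with
  | false, false => 0
  | true, false => << a%:R *g (false, false, q.+1, (al + m1)%N) >>
  | false, true => << - b%:R *g (false, false, q.+1, (al + m2)%N) >>
  | true, true => << b%:R *g (true, false, q.+1, (al + m2)%N) >> +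
                  << a%:R *g (false, true, q.+1, (al + m1)%N) >>
  end.

Definition diff (z : {malg k[cell]}) : {malg k[cell]} :=
  \sum_(c <- msupp z) z@_c *: cell_diff c.

(* z is an element of the complex, homogeneous of bidegree (m, n) *)
Definition cochain (m : nat) (n : int) (z : {malg k[cell]}) : Prop :=
  forall c : cell, c \in msupp z -> in_S c.2 /\ bideg c = (m, n).

Definition cocycle m n z : Prop := cochain m n z /\ diff z = 0.

Definition coboundary m n z : Prop :=
  if m is m'.+1 then exists w, cochain m' n w /\ z = diff w else z = 0.

End Complex.

(* The quotient Z/B of subspaces B <= Z of V is finite-dimensional, of
   dimension d: some family of d elements of Z is a basis of it. *)
Definition quotient_dim (k : fieldType) (V : lmodType k) (Z B : V -> Prop)
    (d : nat) : Prop :=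
  exists z : 'I_d -> V, (forall i, Z (z i)) /\
    (forall u, Z u ->
       exists! c : {ffun 'I_d -> k}, B (u - \sum_(i < d) c i *: z i)).

(* dim_k HH^{m,n}(A) = d *)
Definition HH_dim (k : fieldType) (a b : nat) (m : nat) (n : int) (d : nat) :=
  quotient_dim (@cocycle k a b m n) (@coboundary k a b m n) d.

(* f is the Hilbert series of HH^*(A) *)
Definition is_HH_Hilbert_series (k : fieldType) (a b : nat) (f : xyseries) :=
  forall (m : nat) (n : int),
    exists d : nat, HH_dim k a b m n d /\ ser_coef f m n = d%:Z.

(* Main.v *)
From HB Require Import structures.
Require Import Defs.
From mathcomp Require Import boolp classical_sets fsbigop finmap monalg.
From mathcomp Require Import all_boot all_order all_algebra.
From mathcomp Require Import zify ring.

Set Implicit Arguments.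
Unset Strict Implicit.
Unset Printing Implicit Defensive.

Import Order.TTheory GRing.Theory Num.Theory.

Local Open Scope ring_scope.

(** Put N = n + q a b. In weight n the complex has, up to scalars, at most one
    cell of each type: t^(q), with exponent N, and e_1 e_2 t^(q-1), with exponent
    N + a + b - ab, in degree 2q; e_1 t^(q), with exponent N + b, and e_2 t^(q),
    with exponent N + a, in degree 2q + 1. As a and b are nonzero in k, cocycles
    and coboundaries are both contained in one line in each bidegree, and the
    dimension of the cohomology is a difference of truth values of memberships
    in S. Summing them rests on one arithmetic fact: N + a and N + b both lie in
    S exactly when N lies in S or N is the Frobenius number ab - a - b. *)

Definition sgp (a b : nat) (n : int) : bool :=
  `[< exists2 al : nat, in_S a b al & n = al%:Z >].

(** * Membership of integers, negative ones included, in the semigroup S generated by [a] and [b] *)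

Section Semigroup.
Variables a b : nat.

Lemma sgpP (n : int) :
  reflect (exists i j : nat, n = i%:Z * a%:Z + j%:Z * b%:Z) (sgp a b n).
Proof.
apply: (iffP idP) => [/asboolP [al [i [j ->]] ->]|[i [j ->]]].
  by exists i, j; lia.
by apply/asboolP; exists (i * a + j * b)%N; [exists i, j | lia].
Qed.

Lemma sgp_ge0 n : sgp a b n -> 0 <= n.
Proof. by move/sgpP => [i [j ->]]; lia. Qed.

Lemma sgp_lt0 n : n < 0 -> sgp a b n = false.
Proof. by move=> n0; apply: contraTF n0 => /sgp_ge0; lia. Qed.

Lemma sgp_in_S n : sgp a b n -> in_S a b `|n|%N.
Proof. by case/asboolP => al al_S ->. Qed.

Lemma in_S_sgp (al : nat) : in_S a b al -> sgp a b al%:Z.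
Proof. by move=> al_S; apply/asboolP; exists al. Qed.

Lemma sgpDl n (i : nat) : sgp a b n -> sgp a b (n + i%:Z * a%:Z).
Proof. by move/sgpP => [i' [j ->]]; apply/sgpP; exists (i' + i)%N, j; lia. Qed.

Lemma sgpDr n (j : nat) : sgp a b n -> sgp a b (n + j%:Z * b%:Z).
Proof. by move/sgpP => [i [j' ->]]; apply/sgpP; exists i, (j' + j)%N; lia. Qed.

Hypotheses (a_gt0 : (0 < a)%N) (b_gt0 : (0 < b)%N).

(** A nonzero element of S uses [a] or [b] at least once, and removing one copy leaves an element of
    S. At 0 both shifted integers are negative, so the two summands on the right are never both
    1. *)
Lemma sgp_either (n : int) :
  (sgp a b (n + a%:Z + b%:Z) : nat) =
  ((sgp a b (n + a%:Z) || sgp a b (n + b%:Z)) + (n + a%:Z + b%:Z == 0)%R)%N.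
Proof.
have [/eqP n0|n0] := boolP (n + a%:Z + b%:Z == 0).
  rewrite (sgp_lt0 _ (n := n + a%:Z)) ?(sgp_lt0 _ (n := n + b%:Z)); try lia.
  by rewrite n0; congr nat_of_bool; apply/sgpP; exists 0%N, 0%N.
rewrite addn0; congr nat_of_bool; apply/idP/orP => [/sgpP [i [j e]]|].
  case: i e => [|i] e; last by right; apply/sgpP; exists i, j; lia.
  case: j e => [|j] e; first by case/eqP: n0; lia.
  by left; apply/sgpP; exists 0%N, j; lia.
case => [/(sgpDr 1)|/(sgpDl 1)]; rewrite mul1r //.
by rewrite addrAC.
Qed.

(** Add (b-1)a, respectively (a-1)b. This is the inclusion of coboundaries in cocycles in odd
    degree. *)
Lemma sgp_both_of_sub n : sgp a b (n + a%:Z + b%:Z - (a * b)%N%:Z) ->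
  sgp a b (n + b%:Z) && sgp a b (n + a%:Z).
Proof.
move=> p; apply/andP; split.
- by have := sgpDl b.-1 p; congr sgp; nia.
- by have := sgpDr a.-1 p; congr sgp; nia.
Qed.

(** Add (a-1)b, respectively (b-1)a. This is the inclusion of coboundaries in cocycles in even
    degree. *)
Lemma sgp_of_either n :
  sgp a b (n - (a * b)%N%:Z + b%:Z) || sgp a b (n - (a * b)%N%:Z + a%:Z) ->
  sgp a b n.
Proof.
case/orP=> p.
- by have := sgpDr a.-1 p; congr sgp; nia.
- by have := sgpDl b.-1 p; congr sgp; nia.
Qed.

Hypothesis coprime_ab : coprime a b.

Let c : int := (a * b)%N%:Z - a%:Z - b%:Z.

(** A representation of [c] would give ab = (i+1)a + (j+1)b. By coprimality b divides i+1 and a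
    divides j+1, so the right side would be at least 2ab. *)
Lemma Frobenius_notin_sgp : sgp a b c = false.
Proof.
apply/negP => /sgpP [i [j ec]].
have e : (i.+1 * a + j.+1 * b = a * b)%N by rewrite /c in ec; lia.
have /dvdnP [s es] : (b %| i.+1)%N.
  rewrite -(Gauss_dvdl _ (p := a)); last by rewrite coprime_sym.
  by rewrite -(dvdn_addl _ (dvdn_mull j.+1 (dvdnn b))) e dvdn_mull.
have /dvdnP [t et] : (a %| j.+1)%N.
  rewrite -(Gauss_dvdl _ coprime_ab).
  by rewrite -(dvdn_addr _ (dvdn_mull i.+1 (dvdnn a))) e dvdn_mulr.
case: s es => [|s] es; first lia.
case: t et => [|t] et; first lia.
by rewrite es et in e; nia.
Qed.

(** If n is outside S while n+a and n+b are inside, then n+a = jb and n+b = i'a, since any other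
    representation could be shortened to one of n. Hence (j+1)b = (i'+1)a is a multiple tab, and n =
    tab - a - b; only t = 1 leaves n outside S. *)
Lemma sgp_both (n : int) :
  (sgp a b (n + a%:Z) && sgp a b (n + b%:Z) : nat) = (sgp a b n + (n == c))%N.
Proof.
have [n_S|n_S] := boolP (sgp a b n).
  have -> : (n == c) = false.
    by apply: contraTF n_S => /eqP ->; rewrite Frobenius_notin_sgp.
  by have := sgpDl 1 n_S; have := sgpDr 1 n_S; rewrite !mul1r => -> ->.
rewrite add0n; congr nat_of_bool; apply/andP/eqP => [[]|->].
  move=> /sgpP [i [j eb]] /sgpP [i' [j' ea]].
  case: i eb => [|i] eb; last first.
    by case/negP: n_S; apply/sgpP; exists i, j; lia.
  case: j' ea => [|j'] ea; last first.
    by case/negP: n_S; apply/sgpP; exists i', j'; lia.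
  have e : (j.+1 * b = i'.+1 * a)%N by lia.
  have /dvdnP [t et] : (a %| j.+1)%N.
    by rewrite -(Gauss_dvdl _ coprime_ab) e dvdn_mull.
  case: t et => [|[|t]] et; first lia.
    by rewrite /c; nia.
  (* For a multiplier t+2 at least 2: (t+2)ab - a - b = (b-1)a + (ta+a-1)b. *)
  case/negP: n_S; apply/sgpP; exists (b.-1), (t * a + a.-1)%N.
  have -> : n = (t.+2 * a * b)%N%:Z - a%:Z - b%:Z by rewrite -et; lia.
  by case: (a) (b) a_gt0 b_gt0 => [//|a'] [//|b'] _ _ /=; lia.
rewrite /c; split; apply/sgpP.
- by exists 0%N, a.-1; case: (a) a_gt0 => //= a' _; lia.
- by exists b.-1, 0%N; case: (b) b_gt0 => //= b' _; lia.
Qed.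

End Semigroup.

(** * Coefficients of products with constants and monomials, in power series and in Laurent
    series *)

Section PSeriesConst.
Variable R : comNzRingType.
Implicit Types (c d : R) (f : pseries R).

Lemma pscoefD f g m : pscoef (f + g) m = pscoef f m + pscoef g m.
Proof. by []. Qed.

Lemma pscoefN f m : pscoef (- f) m = - pscoef f m.
Proof. by []. Qed.

Lemma pscoef_mulC f c m : pscoef (f * ps_const c) m = pscoef f m * c.
Proof.
rewrite [LHS]/= big_ord_recr /= subnn eqxx big1 ?add0r // => i _.
by rewrite subn_eq0 leqNgt ltn_ord mulr0.
Qed.

Lemma pscoef_mulX f m : pscoef (ps_X R * f) m = if m is m'.+1 then pscoef f m' else 0.
Proof.
rewrite [LHS]/=; case: m => [|m]; first by rewrite big_ord1 mul0r.
rewrite 2!big_ord_recl /= mul0r add0r mul1r subSS subn0 big1 ?addr0 // => i _.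
by rewrite mul0r.
Qed.

Fact ps_const_zmod : zmod_morphism (@ps_const R).
Proof. by move=> c d; apply: pseriesP => -[|m] //=; rewrite subr0. Qed.

Fact ps_const_monoid : monoid_morphism (@ps_const R).
Proof.
split=> // c d; apply: pseriesP => m.
by rewrite pscoef_mulC; case: m => [|m] //=; rewrite mul0r.
Qed.

HB.instance Definition _ :=
  GRing.isZmodMorphism.Build R (pseries R) (@ps_const R) ps_const_zmod.
HB.instance Definition _ :=
  GRing.isMonoidMorphism.Build R (pseries R) (@ps_const R) ps_const_monoid.

End PSeriesConst.

Section LaurentCoef.
Variable R : comNzRingType.
Implicit Types (f g : laurent R).

Lemma lcoefD f g n : lcoef (f + g) n = lcoef f n + lcoef g n.
Proof. by []. Qed.

Lemma lcoefN f n : lcoef (- f) n = - lcoef f n.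
Proof. by []. Qed.

Lemma lcoef_monoM (j : int) f n : lcoef (lmono 1 j * f) n = lcoef f (n - j).
Proof.
rewrite [LHS]/= /lmul_coef -(@fsbig_widen _ _ _ _ [set j]) //=.
  by rewrite fsbig_set1 eqxx mul1r.
by move=> i [_ /= /eqP/negbTE ij]; rewrite /= ij mul0r.
Qed.

Lemma lmono1M (i j : int) : lmono (1 : R) i * lmono 1 j = lmono 1 (i + j).
Proof.
by apply: laurentP => n; rewrite lcoef_monoM /= subr_eq addrC.
Qed.

Lemma lmono1X (i : int) n : lmono (1 : R) i ^+ n = lmono 1 (i * n%:Z).
Proof.
elim: n => [|n IHn]; first by rewrite mulr0.
by rewrite exprS IHn lmono1M; congr lmono; lia.
Qed.

End LaurentCoef.

(** * Expansion of the rational expressions in the Hilbert series *)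

Section Series.
Variables a b : nat.

Fact sgp_laurent_subproof (d e : nat) :
  exists N : nat, forall n : int, n < - N%:Z -> (sgp d e n : nat)%:Z = 0.
Proof. by exists 0%N => n n0; rewrite sgp_lt0 //; lia. Qed.

(** At (a, b) this is the Hilbert series of A; at (d, 0) it is the geometric series of y^d, hence
    parameters separate from [a] and [b]. *)
Definition sgp_laurent d e : laurent int := Laurent (sgp_laurent_subproof d e).

Lemma ser_yX n : ser_y ^+ n = ps_const (lmono 1 n%:Z).
Proof. by rewrite /ser_y -rmorphXn lmono1X mul1r. Qed.

Lemma ser_yV n : ser_y ^- n = ps_const (lmono 1 (- n%:Z)).
Proof.
apply: mulr1_eq; rewrite ser_yX -rmorphM lmono1M subrr.
exact: (rmorph1 (@ps_const _)).
Qed.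

Lemma ser_yz (n : int) : ser_y ^ n = ps_const (lmono 1 n).
Proof.
case: n => n; first exact: ser_yX.
by rewrite NegzE -exprnN ser_yV.
Qed.

Lemma laurent_geo_inv (d : nat) : (0 < d)%N ->
  (1 - lmono 1 d%:Z) * sgp_laurent d 0 = 1.
Proof.
move=> d_gt0; apply: laurentP => n; rewrite mulrBl mul1r lcoefD lcoefN lcoef_monoM.
rewrite /=; have [->|/eqP n0] := eqVneq n 0.
  rewrite (@sgp_lt0 _ _ (0 - _)); last lia.
  by have -> : sgp d 0 0 by apply/sgpP; exists 0%N, 0%N; lia.
apply/eqP; rewrite subr_eq0; apply/eqP; congr (Posz (nat_of_bool _)).
apply/sgpP/sgpP => [[[|i] [j e]]|[i [j e]]]; first by case: n0; lia.
  by exists i, j; lia.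
by exists i.+1, j; lia.
Qed.

Lemma unit_1B_ser_yX d : (0 < d)%N -> (1 - ser_y ^+ d) \is a GRing.unit.
Proof.
move=> d_gt0; apply/unitrPr; exists (ps_const (sgp_laurent d 0)).
rewrite ser_yX -[X in X - _](rmorph1 (@ps_const _)) -rmorphB -rmorphM.
by rewrite laurent_geo_inv // rmorph1.
Qed.

Definition geo_series (d : nat) : xyseries := PSeries (fun m =>
  if (0 < m)%N && ~~ odd m then lmono 1 (- (m./2 * d)%N%:Z) else 0).

Lemma geo_seriesE d : let u := ser_x ^+ 2 * ser_y ^- d in
  u / (1 - u) = geo_series d.
Proof.
move=> u; have e : geo_series d * (1 - u) = u.
  (* Writing u as x times x times y^-d lets each factor x act as a shift of coefficients. *)
  have -> : geo_series d * (1 - u) =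
      geo_series d - ser_x * (ser_x * (geo_series d * ser_y ^- d)).
    by rewrite /u; ring.
  have -> : u = ser_x * (ser_x * ser_y ^- d) by rewrite /u; ring.
  rewrite ser_yV; apply: pseriesP => m; rewrite pscoefD pscoefN.
  case: m => [|[|m]]; rewrite !pscoef_mulX ?subr0 // pscoef_mulC /= ?negbK.
  case: m => [|m] /=; first by rewrite mul0r subr0 mul1n.
  rewrite negbK; case: ifP => _; last by rewrite mul0r subrr.
  rewrite lmono1M; apply/eqP; rewrite subr_eq0; apply/eqP; congr lmono; lia.
(* The identity [e] also inverts 1 - u: multiplying it by 1 + [geo_series d] gives 1 - u + u = 1. *)
have uu : 1 - u \is a GRing.unit.
  by apply/unitrPr; exists (1 + geo_series d);
     rewrite mulrDr mulr1 [_ * geo_series d]mulrC e subrK.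
by rewrite -[X in X / _]e mulrK.
Qed.

(** Normal form for the even part of the Hilbert series and for the odd part divided by x. For d =
    ab and m = 2q > 0, the coefficient of [g] is read at N = n + qab. *)
Lemma ser_coef_geo d (f g : laurent int) m n :
  ser_coef (ps_const f + geo_series d * ps_const g) m n =
  if odd m then 0 else
  if m == 0%N then lcoef f n else lcoef g (n + (m./2 * d)%N%:Z).
Proof.
rewrite /ser_coef pscoefD pscoef_mulC.
case: m => [|m]; first by rewrite [pscoef (geo_series d) 0]/= mul0r addr0.
have -> : pscoef (ps_const f) m.+1 = 0 by [].
have -> : pscoef (geo_series d) m.+1 =
  if ~~ odd m.+1 then lmono 1 (- (m.+1./2 * d)%N%:Z) else 0 by [].
rewrite add0r; case: (odd m.+1); last by rewrite lcoef_monoM opprK.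
by rewrite [~~ _]/= mul0r /= if_same.
Qed.

Lemma ser_coef_DX (f g : xyseries) m n :
  ser_coef (f + ser_x * g) m n =
  ser_coef f m n + (if m is m'.+1 then ser_coef g m' n else 0).
Proof. by rewrite /ser_coef pscoefD pscoef_mulX; case: m => [|m] //; rewrite !addr0. Qed.

Hypotheses (a_gt0 : (0 < a)%N) (b_gt0 : (0 < b)%N) (coprime_ab : coprime a b).

(** With M = n-a-b, the coefficient of y^n on the left is [n in S] - [n-a in S] - [n-b in S] +
    [M in S]. Inclusion-exclusion through [sgp_either] and [sgp_both] at M reduces it to [n = 0] -
    [n = ab]. *)
Lemma sgp_laurentM :
  (1 - lmono 1 a%:Z) * (1 - lmono 1 b%:Z) * sgp_laurent a b =
  1 - lmono 1 (a * b)%N%:Z.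
Proof.
have -> : (1 - lmono 1 a%:Z) * (1 - lmono 1 b%:Z) * sgp_laurent a b =
   sgp_laurent a b - lmono 1 a%:Z * sgp_laurent a b -
   lmono 1 b%:Z * sgp_laurent a b +
   lmono 1 a%:Z * (lmono 1 b%:Z * sgp_laurent a b) by ring.
apply: laurentP => n; rewrite !(lcoefD, lcoefN, lcoef_monoM) /=.
pose M := n - a%:Z - b%:Z.
have := sgp_either a_gt0 b_gt0 M; have := sgp_both a_gt0 b_gt0 coprime_ab M.
have -> : M + a%:Z = n - b%:Z by rewrite /M; lia.
have -> : M + b%:Z = n - a%:Z by rewrite /M; lia.
have -> : n - b%:Z + b%:Z = n by lia.
have -> : (M == (a * b)%N%:Z - a%:Z - b%:Z) = (n == (a * b)%N%:Z).
  by rewrite /M; apply/eqP/eqP; lia.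
rewrite -/M; case: (sgp a b n); case: (sgp a b M);
case: (sgp a b (n - a%:Z)); case: (sgp a b (n - b%:Z));
by case: eqP; case: eqP => //=; lia.
Qed.

Lemma sgp_seriesE : (1 - ser_y ^+ (a * b)) / ((1 - ser_y ^+ a) * (1 - ser_y ^+ b)) =
  ps_const (sgp_laurent a b).
Proof.
have uD : (1 - ser_y ^+ a) * (1 - ser_y ^+ b) \is a GRing.unit.
  by rewrite unitrM !unit_1B_ser_yX.
apply: (canLR (mulrK uD)); rewrite !ser_yX.
rewrite -[X in X - _](rmorph1 (@ps_const _)) -!rmorphB -!rmorphM -sgp_laurentM.
by congr ps_const; rewrite mulrC.
Qed.

End Series.

(** The dimension of the cocycles minus that of the coboundaries. The second truth value implies the
    first, by [sgp_both_of_sub] and [sgp_of_either], so truncated subtraction is exact. The guard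
    [0 < m./2] reflects that degrees 0 and 1 have no nonzero coboundary. *)
Definition HH_rank (a b m : nat) (n : int) : nat :=
  let N := n + (m./2 * (a * b))%N%:Z in
  if odd m then
    ((sgp a b (N + b%:Z) && sgp a b (N + a%:Z)) -
     ((0 < m./2) && sgp a b (N + a%:Z + b%:Z - (a * b)%N%:Z)))%N
  else
    (sgp a b N -
     ((0 < m./2) && (sgp a b (N - (a * b)%N%:Z + b%:Z) ||
                     sgp a b (N - (a * b)%N%:Z + a%:Z))))%N.

(** * Quotients of subspaces of a line *)

Section QuotientLine.
Variables (k : fieldType) (V : lmodType k) (e : V).

(** The span of [e] if [p] holds and the zero subspace otherwise. *)
Definition subline (p : bool) (u : V) : Prop :=
  exists2 x : k, u = x *: e & x != 0 -> p.

Lemma quotient_dim_subline (p r : bool) (Z B : V -> Prop) :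
  e != 0 -> (r -> p) ->
  (forall u, Z u <-> subline p u) -> (forall u, B u <-> subline r u) ->
  quotient_dim Z B (p - r).
Proof.
move=> e_neq0 rp ZE BE.
(* Either Z = B and the empty family is a basis of the quotient, or Z is the whole line, B = 0 and
   [e] is a basis. *)
have [d0|d1] : ((p - r = 0)%N /\ (p -> r)) \/ [/\ (p - r = 1)%N, p & ~~ r].
- by case: p r rp {ZE BE} => [] [] //=; [left | right | left | left].
- case: d0 => -> pr; exists (fun=> 0); split=> [[]//|u /ZE[x -> px]].
  exists [ffun=> 0]; split=> [|c _]; last by apply/ffunP => -[].
  by rewrite big_ord0 subr0; apply/BE; exists x => // /px/pr.
- case: d1 => -> p_true r_false; exists (fun=> e); split=> [_|u /ZE[x -> _]].
    by apply/ZE; exists 1; rewrite ?scale1r.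
  exists [ffun=> x]; split=> [|c].
    by rewrite big_ord1 ffunE subrr; apply/BE; exists 0; rewrite ?scale0r ?eqxx.
  rewrite big_ord1 => /BE[y e_y r_y]; apply/ffunP => i; rewrite ffunE (ord1 i).
  have y0 : y = 0 by apply/eqP; apply: contraNT r_false => /r_y.
  move/eqP: e_y; rewrite y0 scale0r -scalerBl scaler_eq0 (negPf e_neq0) orbF.
  by rewrite subr_eq0 => /eqP.
Qed.

End QuotientLine.

(** * Linear combinations of two basis elements *)

Section MalgPair.
Variables (k : fieldType) (K : choiceType).
Implicit Types (z : {malg k[K]}) (c : K) (t x y : k).

Lemma malgU_scale x y c : x *: (<< y *g c >> : {malg k[K]}) = << x * y *g c >>.
Proof. by apply/malgP => c'; rewrite mcoeffZ !mcoeffU mulrnAr. Qed.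

Lemma malgU_D x y c :
  (<< x + y *g c >> : {malg k[K]}) = << x *g c >> + << y *g c >>.
Proof. by apply/malgP => c'; rewrite mcoeffD !mcoeffU mulrnDl. Qed.

Lemma malg_pair_scale t x y c1 c2 :
  t *: (<< x *g c1 >> + << y *g c2 >> : {malg k[K]}) =
  << t * x *g c1 >> + << t * y *g c2 >>.
Proof. by rewrite scalerDr !malgU_scale. Qed.

Lemma malgU_0 c : (<< 0 *g c >> : {malg k[K]}) = 0.
Proof. by apply/malgP => c'; rewrite mcoeff0 mcoeffU mul0rn. Qed.

Lemma mcoeff_pairl x y c1 c2 : c1 != c2 ->
  (<< x *g c1 >> + << y *g c2 >> : {malg k[K]})@_c1 = x.
Proof.
by move=> c12; rewrite mcoeffD !mcoeffU eqxx [c2 == c1]eq_sym (negPf c12) addr0.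
Qed.

Lemma msupp_pair x y c1 c2 c :
  c \in msupp (<< x *g c1 >> + << y *g c2 >> : {malg k[K]}) ->
  (c = c1 /\ x != 0) \/ (c = c2 /\ y != 0).
Proof.
move=> /(fsubsetP (msuppD_le _ _)); rewrite in_fsetU !msuppU.
by case/orP; case: eqVneq => // _; rewrite in_fset1 => /eqP; [left|right].
Qed.

Lemma malg_pairE z c1 c2 : c1 != c2 ->
  (forall c, c \in msupp z -> c = c1 \/ c = c2) ->
  z = << z@_c1 *g c1 >> + << z@_c2 *g c2 >>.
Proof.
move=> c12 zS; apply/malgP => c; rewrite mcoeffD !mcoeffU.
have [<-|n1] := eqVneq c1 c; first by rewrite eq_sym (negPf c12) addr0.
have [<-|n2] := eqVneq c2 c; first by rewrite add0r.
rewrite addr0; apply: mcoeff_outdom; apply/negP => /zS[] e;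
  by move: n1 n2; rewrite e eqxx.
Qed.

End MalgPair.

(** * The differential, and the cochains of a given bidegree *)

Section Cohomology.
Variables (k : fieldType) (a b : nat).
Local Notation M := {malg k[cell]}.
Implicit Types (z w : M) (c : cell).

Lemma diffEw (D : {fset cell}) z : (msupp z `<=` D)%fset ->
  diff a b z = \sum_(c <- D) z@_c *: cell_diff k a b c.
Proof.
move=> zD; apply: big_fset_incl => // c _ /mcoeff_outdom ->.
by rewrite scale0r.
Qed.

Lemma diffD z w : diff a b (z + w) = diff a b z + diff a b w.
Proof.
rewrite (diffEw (msuppD_le z w)) (diffEw (fsubsetUl (msupp z) (msupp w))).
rewrite (diffEw (fsubsetUr (msupp z) (msupp w))) -big_split /=.
by apply: eq_bigr => c _; rewrite mcoeffD scalerDl.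
Qed.

Lemma diffU x c : diff a b << x *g c >> = x *: cell_diff k a b c.
Proof. by rewrite (diffEw msuppU_le) big_seq_fset1 mcoeffUU. Qed.

(** A false [p1] or [p2] allows for a candidate cell that is absent from the complex in this
    bidegree; its coefficient must then vanish. *)
Lemma cochain_cells2 (m : nat) (n : int) (c1 c2 : cell) (p1 p2 : bool) :
  c1 != c2 ->
  (forall c, in_S a b c.2 -> bideg a b c = (m, n) ->
     (c = c1 /\ p1) \/ (c = c2 /\ p2)) ->
  (p1 -> in_S a b c1.2 /\ bideg a b c1 = (m, n)) ->
  (p2 -> in_S a b c2.2 /\ bideg a b c2 = (m, n)) ->
  forall z, cochain a b m n z <->
    exists x y : k, [/\ z = << x *g c1 >> + << y *g c2 >>,
                        x != 0 -> p1 & y != 0 -> p2].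
Proof.
move=> c12 cells S1 S2 z; split=> [zC|[x [y [-> x1 y2]]] c]; last first.
  by case/msupp_pair => [] [->] => [/x1/S1|/y2/S2].
have cellsz c : c \in msupp z -> (c = c1 /\ p1) \/ (c = c2 /\ p2).
  by case/zC; apply: cells.
exists (z@_c1), (z@_c2); split.
- by apply: malg_pairE => // c /cellsz[[-> _]|[-> _]]; [left|right].
- rewrite mcoeff_neq0 => /cellsz[[_ //]|[e _]]; by move: c12; rewrite e eqxx.
- rewrite mcoeff_neq0 => /cellsz[[e _]|[_ //]]; by move: c12; rewrite e eqxx.
Qed.

(* [absz] gives a wrong exponent when the integer inside is negative; such a cell
   only ever occurs with coefficient 0, since that integer is then not in S. *)
Definition cell_0 (q : nat) (n : int) : cell :=
  (false, false, q, absz (n + (q * (a * b))%N%:Z)%R).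
Definition cell_12 (q : nat) (n : int) : cell :=
  (true, true, q.-1, absz (n + (q * (a * b))%N%:Z + a%:Z + b%:Z - (a * b)%N%:Z)%R).
Definition cell_1 (q : nat) (n : int) : cell :=
  (true, false, q, absz (n + (q * (a * b))%N%:Z + b%:Z)%R).
Definition cell_2 (q : nat) (n : int) : cell :=
  (false, true, q, absz (n + (q * (a * b))%N%:Z + a%:Z)%R).

(** Parity excludes the cells with exactly one of e_1, e_2. The guard [0 < q] is needed because at q
    = 0 the index [q.-1] in [cell_12] is only a default. *)
Lemma cochain_even q n z : cochain a b (2 * q) n z <->
  exists x y : k, [/\ z = << x *g cell_0 q n >> + << y *g cell_12 q n >>,
    x != 0 -> sgp a b (n + (q * (a * b))%N%:Z) &
    y != 0 -> (0 < q)%N &&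
              sgp a b (n + (q * (a * b))%N%:Z + a%:Z + b%:Z - (a * b)%N%:Z)].
Proof.
apply: cochain_cells2 => //.
- move=> [[[[] []] q'] al] /= /in_S_sgp alS [e1 e2].
  + have e : (0 < q)%N /\ q' = q.-1 by lia.
    case: e e2 => q_gt0 -> e2; right.
    have qE : (q.-1 * (a * b) + a * b = q * (a * b))%N
      by case: (q) q_gt0 => //= q'' _; lia.
    have alE : n + (q * (a * b))%N%:Z + a%:Z + b%:Z - (a * b)%N%:Z = al%:Z by lia.
    by rewrite /cell_12 alE absz_nat q_gt0 alS.
  + by lia.
  + by lia.
  + have qE : q' = q by lia.
    have alE : n + (q * (a * b))%N%:Z = al%:Z by rewrite -e2 qE; lia.
    by left; rewrite /cell_0 alE absz_nat qE alS.
- move=> p; split; first exact: sgp_in_S.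
  have := sgp_ge0 p; rewrite /cell_0 /bideg => p0; congr pair; lia.
- case/andP => q_gt0 p; split; first exact: sgp_in_S.
  have qE : (q.-1 * (a * b) + a * b = q * (a * b))%N
      by case: (q) q_gt0 => //= q'' _; lia.
  have := sgp_ge0 p; rewrite /cell_12 /bideg => p0; congr pair; lia.
Qed.

Lemma cochain_odd q n z : cochain a b (2 * q).+1 n z <->
  exists x y : k, [/\ z = << x *g cell_1 q n >> + << y *g cell_2 q n >>,
    x != 0 -> sgp a b (n + (q * (a * b))%N%:Z + b%:Z) &
    y != 0 -> sgp a b (n + (q * (a * b))%N%:Z + a%:Z)].
Proof.
apply: cochain_cells2 => //.
- move=> [[[[] []] q'] al] /= /in_S_sgp alS [e1 e2].
  + by lia.
  + have qE : q' = q by lia.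
    have alE : n + (q * (a * b))%N%:Z + b%:Z = al%:Z.
      by rewrite -e2 qE; lia.
    by left; rewrite /cell_1 alE absz_nat qE alS.
  + have qE : q' = q by lia.
    have alE : n + (q * (a * b))%N%:Z + a%:Z = al%:Z.
      by rewrite -e2 qE; lia.
    by right; rewrite /cell_2 alE absz_nat qE alS.
  + by lia.
- move=> p; split; first exact: sgp_in_S.
  have := sgp_ge0 p; rewrite /cell_1 /bideg => p0; congr pair; lia.
- move=> p; split; first exact: sgp_in_S.
  have := sgp_ge0 p; rewrite /cell_2 /bideg => p0; congr pair; lia.
Qed.

End Cohomology.

(** * Cocycles, coboundaries and the dimension of the cohomology *)

Section CohomologyDimension.
Variables (k : fieldType) (a b : nat).
Local Notation M := {malg k[cell]}.
Implicit Types (z w : M) (q : nat) (n : int).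

(** The formula for the differential of [cell_12], written out because it must also span the odd
    cocycles when [cell_12] does not lie in the complex. *)
Definition cochain_12_diff q n : M :=
  << b%:R *g cell_1 a b q n >> + << a%:R *g cell_2 a b q n >>.

Lemma diff0 : diff a b (0 : M) = 0.
Proof. by rewrite /diff msupp0 big_seq_fset0. Qed.

Lemma diff_cell_0 x q n : diff a b (<< x *g cell_0 a b q n >> : M) = 0.
Proof. by rewrite diffU scaler0. Qed.

Hypotheses (a_gt0 : (0 < a)%N) (b_gt0 : (0 < b)%N).

Lemma diff_cell_12 (y : k) q n :
  (y != 0 -> (0 < q)%N &&
             sgp a b (n + (q * (a * b))%N%:Z + a%:Z + b%:Z - (a * b)%N%:Z)) ->
  diff a b << y *g cell_12 a b q n >> = y *: cochain_12_diff q n.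
Proof.
have [->|y0 /(_ isT)/andP[q_gt0 /sgp_ge0 p]] := eqVneq y 0.
  by move=> _; rewrite diffU; apply: etrans (scale0r _) (esym (scale0r _)).
set N := n + (q * (a * b))%N%:Z in p *.
(* By [p] the integer inside is nonnegative, so the absolute values add up: shifting by m_2 gives
   N+b and shifting by m_1 gives N+a. *)
have e1 : (`|(N + a%:Z + b%:Z - (a * b)%N%:Z)%R| + a * (b - 1) =
    `|(N + b%:Z)%R|)%N by nia.
have e2 : (`|(N + a%:Z + b%:Z - (a * b)%N%:Z)%R| + b * (a - 1) =
    `|(N + a%:Z)%R|)%N by nia.
by rewrite diffU /cochain_12_diff /cell_1 /cell_2 -e1 -e2 -[in RHS](prednK q_gt0).
Qed.

Lemma diff_cell_1 (x : k) q n :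
  (x != 0 -> sgp a b (n + (q * (a * b))%N%:Z + b%:Z)) ->
  diff a b << x *g cell_1 a b q n >> = << x * a%:R *g cell_0 a b q.+1 n >>.
Proof.
have [->|x0 /(_ isT)/sgp_ge0 p] := eqVneq x 0.
  by move=> _; rewrite mul0r !malgU_0 diff0.
set N := n + (q * (a * b))%N%:Z in p *.
have e : (`|(N + b%:Z)%R| + b * (a - 1) = `|(n + (q.+1 * (a * b))%N%:Z)%R|)%N.
  by rewrite /N in p *; nia.
by rewrite diffU /cell_0 -e -malgU_scale.
Qed.

Lemma diff_cell_2 (y : k) q n :
  (y != 0 -> sgp a b (n + (q * (a * b))%N%:Z + a%:Z)) ->
  diff a b << y *g cell_2 a b q n >> = << - (y * b%:R) *g cell_0 a b q.+1 n >>.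
Proof.
have [->|y0 /(_ isT)/sgp_ge0 p] := eqVneq y 0.
  by move=> _; rewrite mul0r oppr0 !malgU_0 diff0.
set N := n + (q * (a * b))%N%:Z in p *.
have e : (`|(N + a%:Z)%R| + a * (b - 1) = `|(n + (q.+1 * (a * b))%N%:Z)%R|)%N.
  by rewrite /N in p *; nia.
by rewrite diffU /cell_0 -e -mulrN -malgU_scale.
Qed.

Lemma diff_even (x y : k) q n :
  (y != 0 -> (0 < q)%N &&
             sgp a b (n + (q * (a * b))%N%:Z + a%:Z + b%:Z - (a * b)%N%:Z)) ->
  diff a b (<< x *g cell_0 a b q n >> + << y *g cell_12 a b q n >>) =
  y *: cochain_12_diff q n.
Proof.
move=> y2; apply: etrans (diffD _ _ _ _) _.
exact: etrans (congr2 +%R (diff_cell_0 x q n) (diff_cell_12 y2)) (add0r _).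
Qed.

Lemma diff_odd (x y : k) q n :
  (x != 0 -> sgp a b (n + (q * (a * b))%N%:Z + b%:Z)) ->
  (y != 0 -> sgp a b (n + (q * (a * b))%N%:Z + a%:Z)) ->
  diff a b (<< x *g cell_1 a b q n >> + << y *g cell_2 a b q n >>) =
  << x * a%:R - y * b%:R *g cell_0 a b q.+1 n >>.
Proof.
move=> x1 y2; apply: etrans (diffD _ _ _ _) _.
exact: etrans (congr2 +%R (diff_cell_1 x1) (diff_cell_2 y2)) (esym (malgU_D _ _ _)).
Qed.

Lemma scale_cochain_12_diff (t : k) q n : t *: cochain_12_diff q n =
  << t * b%:R *g cell_1 a b q n >> + << t * a%:R *g cell_2 a b q n >>.
Proof. exact: malg_pair_scale. Qed.

Hypotheses (a_neq0 : a%:R != 0 :> k) (b_neq0 : b%:R != 0 :> k).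

Lemma cell_12_neq q n : cell_1 a b q n != cell_2 a b q n.
Proof. by []. Qed.

Lemma cochain_12_diff_neq0 q n : cochain_12_diff q n != 0.
Proof.
apply: contraNneq b_neq0 => /(congr1 (mcoeff (cell_1 a b q n))).
by rewrite (mcoeff_pairl _ _ (cell_12_neq q n)) mcoeff0 => ->.
Qed.

Lemma cell_0_neq0 q n : (<< 1 *g cell_0 a b q n >> : M) != 0.
Proof.
apply/eqP => /(congr1 (mcoeff (cell_0 a b q n))).
by rewrite mcoeffUU mcoeff0 => /eqP; rewrite oner_eq0.
Qed.

(** The differential kills [cell_0] and sends [cell_12] to a nonzero vector, so the coefficient of
    [cell_12] in a cocycle is 0. *)
Lemma cocycle_even q n z : cocycle a b (2 * q) n z <->
  subline << 1 *g cell_0 a b q n >> (sgp a b (n + (q * (a * b))%N%:Z)) z.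
Proof.
split=> [[/cochain_even [x [y [-> x1 y2]]]]|[x -> x1]].
  rewrite (diff_even x y2) => /eqP.
  rewrite scaler_eq0 (negPf (cochain_12_diff_neq0 q n)) orbF => /eqP ->.
  by exists x; rewrite // malgU_scale mulr1 malgU_0 addr0.
rewrite malgU_scale mulr1; split; last exact: diff_cell_0.
by apply/cochain_even; exists x, 0; rewrite malgU_0 addr0 eqxx.
Qed.

(** The differential from the preceding degree is (x, y) -> xa - yb. As a and b are invertible in k,
    either source cell alone fills the line, whence the disjunction. *)
Lemma coboundary_even q n z : coboundary a b (2 * q) n z <->
  subline << 1 *g cell_0 a b q n >>
    ((0 < q)%N && (sgp a b (n + (q * (a * b))%N%:Z - (a * b)%N%:Z + b%:Z) ||
                   sgp a b (n + (q * (a * b))%N%:Z - (a * b)%N%:Z + a%:Z))) z.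
Proof.
case: q => [|q].
  split=> [->|[x -> x1]]; first by exists 0; rewrite ?scale0r ?eqxx.
  by have /eqP -> : x == 0 by [apply: contraT => /x1]; apply: scale0r.
have -> : (2 * q.+1 = (2 * q).+2)%N by lia.
have -> : n + (q.+1 * (a * b))%N%:Z - (a * b)%N%:Z = n + (q * (a * b))%N%:Z by lia.
rewrite [(0 < _)%N]/=.
split=> [[w [/cochain_odd [x [y [-> x1 y2]]] ->]]|[x -> x1]].
  rewrite (diff_odd x1 y2).
  exists (x * a%:R - y * b%:R); first by rewrite malgU_scale mulr1.
  have [->|/x1 ->//] := eqVneq x 0.
  have [->|/y2 ->] := eqVneq y 0; first by rewrite !mul0r subrr eqxx.
  by rewrite orbT.
rewrite malgU_scale mulr1; have [->|x0] := eqVneq x 0.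
  by exists 0; rewrite diff0 malgU_0; split=> // c; rewrite msupp0.
case/orP: (x1 x0) => p.
  have xa : x / a%:R != 0 -> sgp a b (n + (q * (a * b))%N%:Z + b%:Z) by [].
  exists << x / a%:R *g cell_1 a b q n >>; split.
    by apply/cochain_odd; exists (x / a%:R), 0; rewrite malgU_0 addr0 eqxx.
  by rewrite (diff_cell_1 xa) mulfVK.
have yb : - x / b%:R != 0 -> sgp a b (n + (q * (a * b))%N%:Z + a%:Z) by [].
exists << - x / b%:R *g cell_2 a b q n >>; split.
  by apply/cochain_odd; exists 0, (- x / b%:R); rewrite malgU_0 add0r eqxx.
by rewrite (diff_cell_2 yb) mulfVK ?opprK.
Qed.

(** The kernel of (x, y) -> xa - yb is spanned by (b, a), whose entries are both nonzero in k; a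
    nonzero cocycle therefore needs both cells, whence the conjunction. *)
Lemma cocycle_odd q n z : cocycle a b (2 * q).+1 n z <->
  subline (cochain_12_diff q n)
    (sgp a b (n + (q * (a * b))%N%:Z + b%:Z) &&
     sgp a b (n + (q * (a * b))%N%:Z + a%:Z)) z.
Proof.
split=> [[/cochain_odd [x [y [-> x1 y2]]]]|[t -> t1]].
  rewrite (diff_odd x1 y2).
  move/(congr1 (mcoeff (cell_0 a b q.+1 n))); rewrite mcoeffUU mcoeff0.
  move/eqP; rewrite subr_eq0 => /eqP xy.
  have ey : x / b%:R * a%:R = y by rewrite mulrAC xy mulfK.
  exists (x / b%:R).
    by apply: etrans (esym (scale_cochain_12_diff _ _ _)); rewrite mulfVK ?ey.
  move=> t0; rewrite x1 ?y2 // -?ey; first exact: mulf_neq0.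
  by apply: contraNneq t0 => ->; rewrite mul0r.
rewrite scale_cochain_12_diff.
have xb : t * b%:R != 0 -> sgp a b (n + (q * (a * b))%N%:Z + b%:Z).
  by rewrite mulf_eq0 negb_or => /andP[/t1/andP[]].
have ya : t * a%:R != 0 -> sgp a b (n + (q * (a * b))%N%:Z + a%:Z).
  by rewrite mulf_eq0 negb_or => /andP[/t1/andP[]].
split; first by apply/cochain_odd; exists (t * b%:R), (t * a%:R).
rewrite (diff_odd xb ya) mulrAC subrr.
exact: malgU_0.
Qed.

Lemma coboundary_odd q n z : coboundary a b (2 * q).+1 n z <->
  subline (cochain_12_diff q n)
    ((0 < q)%N &&
     sgp a b (n + (q * (a * b))%N%:Z + a%:Z + b%:Z - (a * b)%N%:Z)) z.
Proof.
split=> [[w [/cochain_even [x [y [-> x1 y2]]] ->]]|[y -> y2]].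
  by exists y; [exact: diff_even|].
exists << y *g cell_12 a b q n >>; split; last by rewrite (diff_cell_12 y2).
by apply/cochain_even; exists 0, y; rewrite malgU_0 add0r eqxx.
Qed.

Lemma HH_dim_odd q n : HH_dim k a b (2 * q).+1 n (HH_rank a b (2 * q).+1 n).
Proof.
have -> : HH_rank a b (2 * q).+1 n =
    ((sgp a b (n + (q * (a * b))%N%:Z + b%:Z) &&
      sgp a b (n + (q * (a * b))%N%:Z + a%:Z)) -
     ((0 < q) && sgp a b (n + (q * (a * b))%N%:Z + a%:Z + b%:Z - (a * b)%N%:Z)))%N.
  have odd_m : odd (2 * q).+1 by lia.
  have half_m : (2 * q).+1./2 = q by lia.
  by rewrite /HH_rank odd_m half_m.
apply: (quotient_dim_subline (cochain_12_diff_neq0 q n)).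
- by case/andP => _; apply: sgp_both_of_sub.
- by move=> u; apply: cocycle_odd.
- by move=> u; apply: coboundary_odd.
Qed.

Lemma HH_dim_even q n : HH_dim k a b (2 * q) n (HH_rank a b (2 * q) n).
Proof.
have -> : HH_rank a b (2 * q) n =
    (sgp a b (n + (q * (a * b))%N%:Z) -
     ((0 < q) && (sgp a b (n + (q * (a * b))%N%:Z - (a * b)%N%:Z + b%:Z) ||
                  sgp a b (n + (q * (a * b))%N%:Z - (a * b)%N%:Z + a%:Z))))%N.
  by rewrite /HH_rank mul2n odd_double doubleK.
apply: (quotient_dim_subline (cell_0_neq0 q n)).
- by case/andP => _; apply: sgp_of_either.
- by move=> u; apply: cocycle_even.
- by move=> u; apply: coboundary_even.
Qed.

Lemma HH_dimE m n : HH_dim k a b m n (HH_rank a b m n).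
Proof.
rewrite -[m]odd_double_half -mul2n; case: (odd m).
  by rewrite add1n; apply: HH_dim_odd.
by rewrite add0n; apply: HH_dim_even.
Qed.

End CohomologyDimension.

(** * Comparison of the dimensions with the coefficients of the series *)

Lemma natr_neq0_pchar (k : fieldType) (d : nat) : (0 < d)%N ->
  (forall p : nat, p \in [pchar k] -> ~~ (p %| d)%N) -> d%:R != 0 :> k.
Proof.
move=> d_gt0 char_d; rewrite natf_neq0_pchar /pnat d_gt0 /=.
by apply/allP => p; rewrite mem_primes => /and3P[_ _]; apply/contraTN/char_d.
Qed.

Theorem mainTheorem3 (k : fieldType) (a b : nat)
    (a_gt0 : (0 < a)%N) (b_gt0 : (0 < b)%N) (coprime_ab : coprime a b)
    (char_a : forall p : nat, p \in [pchar k] -> ~~ (p %| a)%N)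
    (char_b : forall p : nat, p \in [pchar k] -> ~~ (p %| b)%N) :
  let x := ser_x in
  let y := ser_y in
  let m1 := (b * (a - 1))%N in
  let m2 := (a * (b - 1))%N in
  let u := x ^+ 2 * y ^- (a * b) in
  let c := (a * b)%N%:Z - a%:Z - b%:Z in
  let H1 := (1 - y ^+ (a * b)) / ((1 - y ^+ a) * (1 - y ^+ b)) in
  let H21 := u / (1 - u) * H1 in
  let H22 := u / (1 - u) * y ^+ m1 * H1 in
  let H23 := u / (1 - u) * y ^+ m2 * H1 in
  let H24 := u / (1 - u) * (y ^+ (m1 + m2) + y ^+ (a * b) * H1) in
  let H2 := H21 - (H22 + H23) + H24 in
  let H31 := x * y ^ c + x * H1 in
  let H32 := x * (u / (1 - u)) * H1 in
  let H33 := x * y ^ c * (u / (1 - u)) * (H1 - 1) in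
  let H3 := H31 + H32 - H33 in
  is_HH_Hilbert_series k a b (H1 + H2 + H3).
Proof.
move=> x y m1 m2 u c H1 H21 H22 H23 H24 H2 H31 H32 H33 H3 m n.
exists (HH_rank a b m n); split; first by apply: HH_dimE => //; apply: natr_neq0_pchar.
pose s := sgp_laurent a b; pose Y (j : int) : laurent int := lmono 1 j.
(* [G] and [E] are the cofactors of u/(1-u) in H2 and in H3/x. *)
pose G := s - Y m1%:Z * s - Y m2%:Z * s + Y (m1 + m2)%N%:Z + Y (a * b)%N%:Z * s.
pose E := s + Y c - Y c * s.
have -> : H1 + H2 + H3 = ps_const s + geo_series (a * b) * ps_const G +
    x * (ps_const (Y c + s) + geo_series (a * b) * ps_const E).
  rewrite /H3 /H33 /H32 /H31 /H2 /H24 /H23 /H22 /H21 geo_seriesE.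
  rewrite /H1 sgp_seriesE // /y !ser_yX ser_yz /G /E.
  by rewrite !(rmorphD, rmorphB, rmorphM); ring.
have sE j : lcoef s j = sgp a b j :> int by [].
have YE i j : lcoef (Y i) j = (j == i) :> int by rewrite /=; case: eqP.
rewrite /x ser_coef_DX ser_coef_geo /HH_rank; have [m_odd|m_even] := boolP (odd m).
  case: m m_odd => [//|m] /= m_even; rewrite ser_coef_geo (negPf m_even).
  have -> : uphalf m = m./2 by rewrite uphalf_half (negPf m_even).
  rewrite add0r; have [->|m_neq0] := eqVneq m 0%N.
    rewrite lcoefD YE sE mul0n addr0 ltnn subn0 andbC.
    by rewrite (sgp_both a_gt0 b_gt0 coprime_ab); lia.
  have -> : (0 < m./2)%N by move: m_even m_neq0 => /=; lia.
  (* The coefficient of [E] is [N in S] + [N = c] - [N-c in S]. By [sgp_both] the first two terms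
     give the cocycles, and N-c = N+a+b-ab is the exponent of the coboundaries. *)
  set N := n + _; rewrite !(lcoefD, lcoefN) lcoef_monoM YE sE sE.
  have := @sgp_both_of_sub _ _ a_gt0 b_gt0 N.
  have := sgp_both a_gt0 b_gt0 coprime_ab N; rewrite -/c.
  have -> : N + a%:Z + b%:Z - (a * b)%N%:Z = N - c by rewrite /c; lia.
  rewrite [sgp a b (N + b%:Z) && _]andbC.
  by case: (_ && _) => e; case: (sgp a b (N - c)) => [/(_ isT)//|_]; move: e; lia.
have -> : (if m is m'.+1 then
    ser_coef (ps_const (Y c + s) + geo_series (a * b) * ps_const E) m' n else 0) = 0.
  by case: m m_even => [//|m] /=; rewrite negbK ser_coef_geo => ->.
rewrite addr0; have [->|m_neq0] := eqVneq m 0%N.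
  by rewrite sE mul0n addr0 ltnn subn0.
have -> : (0 < m./2)%N by move: m_even m_neq0; lia.
(* Here N-m1 = N-ab+b and N-m2 = N-ab+a, and N = m1+m2 means that N-ab is the Frobenius number. So
   [sgp_both] at N-ab turns the last two terms of [G] into a conjunction, and inclusion-exclusion
   leaves [N in S] minus the disjunction. *)
set N := n + _; rewrite !(lcoefD, lcoefN) !lcoef_monoM YE !sE.
have := @sgp_of_either _ _ a_gt0 b_gt0 N.
have := sgp_both a_gt0 b_gt0 coprime_ab (N - (a * b)%N%:Z).
have -> : N - (a * b)%N%:Z + b%:Z = N - m1%:Z by rewrite /m1; nia.
have -> : N - (a * b)%N%:Z + a%:Z = N - m2%:Z by rewrite /m2; nia.
have -> : (N - (a * b)%N%:Z == (a * b)%N%:Z - a%:Z - b%:Z) = (N == (m1 + m2)%N%:Z).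
  by apply/eqP/eqP; rewrite /m1 /m2; nia.
case: (sgp a b (N - m1%:Z)); case: (sgp a b (N - m2%:Z)) => /= e.
- by move/(_ isT) => ->; lia.
- by move/(_ isT) => ->; lia.
- by move/(_ isT) => ->; lia.
- by move=> _; lia.
Qed.
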